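(* Let $R$ be a multiplicative hyperring and let $I$ be a proper hyperideal of $R$. Then $I$ is a quasi $J$-prime hyperideal of $R$ if and only if $I\subseteq J(R)$ and, for all $x,y\in R$, $x\circ y\subseteq I$ implies that $x\in J(I)$ or $y\in\sqrt{I}$.
   Context: A multiplicative hyperring is a nonempty set $R$ with an operation $+$ and a hyperoperation $\circ: R\times R\to P^*(R)$ (where $P^*(R)$ is the set of nonempty subsets of $R$) such that: $(R,+)$ is an abelian group; $\circ$ is associative; $a\circ(b+c)\subseteq a\circ b+a\circ c$ and $(b+c)\circ a\subseteq b\circ a+c\circ a$; and $a\circ(-b)=(-a)\circ b=-(a\circ b)$ for all $a,b,c\in R$. For nonempty subsets $A,B\subseteq R$, $A\circ B=\bigcup_{x\in A,\,y\in B}x\circ y$, and $A\circ r=A\circ\{r\}$. Standing assumptions: $R$ is commutative with an identity $1$, meaning $a\in a\circ 1$ for all $a\in R$. A hyperideal of $R$ is a nonempty subset $I\subseteq R$ with $a-b\in I$ for $a,b\in I$ and $r\circ x\subseteq I$ for $x\in I$, $r\in R$. Let $\mathbf{C}=\{r_1\circ r_2\circ\cdots\circ r_n : r_i\in R,\ n\in\mathbb{N}\}$; a hyperideal $I$ is a $\mathbf{C}$-hyperideal if for every $A\in\mathbf{C}$, $A\cap I\neq\varnothing$ implies $A\subseteq I$. Standing assumption: all hyperideals are $\mathbf{C}$-hyperideals. A proper hyperideal $M$ is maximal if every hyperideal $N$ with $M\subsetneq N\subseteq R$ equals $R$; the Jacobson radical $J(R)$ is the intersection of all maximal hyperideals of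 $R$, and for a proper hyperideal $I$, $J(I)$ is the intersection of all maximal hyperideals of $R$ containing $I$. A proper hyperideal $P$ is prime if $x\circ y\subseteq P$ with $x,y\in R$ implies $x\in P$ or $y\in P$. $\sqrt{I}$ is the intersection of all prime hyperideals of $R$ containing $I$ (and $\sqrt{I}=R$ if there are none). A proper hyperideal $I$ is $J$-prime if for all $x,y\in R$, $x\circ y\subseteq I$ implies $x\in J(R)$ or $y\in I$. A proper hyperideal $I$ is quasi $J$-prime if $\sqrt{I}$ is $J$-prime. *)

(* Defs.v *)
From HB Require Import structures.
From mathcomp Require Import all_boot all_algebra.
From mathcomp Require Import boolp classical_sets.

Set Implicit Arguments.
Unset Strict Implicit.
Unset Printing Implicit Defensive.

Import GRing.Theory.
Local Open Scope classical_set_scope.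
Local Open Scope ring_scope.

Definition lift_hop (T : Type) (op : T -> T -> set T) (A B : set T) : set T :=
  \bigcup_(x in A) \bigcup_(y in B) op x y.

HB.mixin Record Zmodule_isMultHyperring R of GRing.Zmodule R := {
  hmul : R -> R -> set R;
  hmul_nonempty : forall a b, hmul a b !=set0;
  hmulA : forall a b c,
    lift_hop hmul [set a] (hmul b c) = lift_hop hmul (hmul a b) [set c];
  hmulDr : forall a b c,
    hmul a (b + c) `<=` [set x + y | x in hmul a b & y in hmul a c];
  hmulDl : forall a b c,
    hmul (b + c) a `<=` [set x + y | x in hmul b a & y in hmul c a];
  hmulrN : forall a b, hmul a (- b) = [set - x | x in hmul a b];
  hmulNr : forall a b, hmul (- a) b = [set - x | x in hmul a b]
}.

#[short(type="multHyperringType")]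
HB.structure Definition MultHyperring :=
  {R of GRing.Zmodule R & Zmodule_isMultHyperring R}.

HB.mixin Record MultHyperring_isComWithOne R of MultHyperring R := {
  hmulC : forall a b : R, hmul a b = hmul b a;
  hone : R;
  hmulr1 : forall a : R, hmul a hone a
}.

#[short(type="comMultHyperringType")]
HB.structure Definition ComMultHyperring :=
  {R of MultHyperring R & MultHyperring_isComWithOne R}.

Section Hyperideals.
Variable R : comMultHyperringType.
Implicit Types (I M N P : set R) (x y r : R).

Definition hyperideal I : Prop :=
  [/\ I !=set0,
      forall a b, I a -> I b -> I (a - b) &
      forall r x, I x -> hmul r x `<=` I].

Definition proper_hyperideal I : Prop := hyperideal I /\ I <> setT.

(* The product of the nonempty sequence r :: s; a single factor gives [set r]. *)
Definition hprod r (s : seq R) : set R :=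
  foldl (fun A t => lift_hop hmul A [set t]) [set r] s.

Definition Cprods : set (set R) := [set A | exists r s, A = hprod r s].

Definition C_hyperideal I : Prop :=
  hyperideal I /\ forall A, Cprods A -> A `&` I !=set0 -> A `<=` I.

Definition maximal_hyperideal M : Prop :=
  proper_hyperideal M /\
  forall N, hyperideal N -> M `<` N -> N = setT.

Definition prime_hyperideal P : Prop :=
  proper_hyperideal P /\ forall x y, hmul x y `<=` P -> P x \/ P y.

Definition jacobson_radical : set R := \bigcap_(M in maximal_hyperideal) M.

Definition jacobson I : set R :=
  \bigcap_(M in [set M | maximal_hyperideal M /\ I `<=` M]) M.

Definition hradical I : set R :=
  \bigcap_(P in [set P | prime_hyperideal P /\ I `<=` P]) P.

Definition J_prime I : Prop :=
  proper_hyperideal I /\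
  forall x y, hmul x y `<=` I -> jacobson_radical x \/ I y.

Definition quasi_J_prime I : Prop :=
  proper_hyperideal I /\ J_prime (hradical I).

End Hyperideals.

Arguments jacobson_radical : clear implicits.

(* Main.v *)
Require Import Defs.
From HB Require Import structures.
From mathcomp Require Import all_boot all_algebra.
From mathcomp Require Import boolp classical_sets.

Set Implicit Arguments.
Unset Strict Implicit.
Unset Printing Implicit Defensive.

Import GRing.Theory.
Local Open Scope classical_set_scope.
Local Open Scope ring_scope.

(** From left to right, [x o 1] lies in [hradical I] for every [x] in [I], so
    [J]-primeness puts [x] in [J(R)], the alternative being that [1] lies in
    the proper hyperideal [hradical I].  The condition on products follows
    from [I `<=` hradical I] and [J(R) `<=` J(I)].

    From right to left, suppose that [x o y] lies in [hradical I], that [x]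
    avoids a maximal hyperideal [M] and that [y] avoids a prime [P] containing
    [I].  Maximal hyperideals are prime, so the elements that occur in some
    [u o v] with [u] outside [M] and [v] outside [P] form a multiplicative
    system [T], in the weak sense that two of its members always have a product
    meeting it ([msystem_mul_setC]).  This [T] misses [I]: otherwise some
    [u o v] would meet, hence lie in, [I], and the hypothesis would put [u] in
    [J(I)], which is contained in [M] because [I `<=` J(R) `<=` M], or [v] in
    [hradical I], which is contained in [P].  Krull's separation theorem
    ([prime_separation]) now gives a prime containing [I] and missing [T]; it
    contains [hradical I], hence [x o y], yet [x o y] is a nonempty subset of
    [T].  Working with [T] replaces the description of the radical by powers
    of elements. *)

Section HyperidealTheory.
Variable R : comMultHyperringType.
Implicit Types (I M N P T : set R) (x y z u v w r : R).

Lemma hmul_exchange u v u' v' w w' z :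
  hmul u v w -> hmul u' v' w' -> hmul w w' z ->
  exists a b, [/\ hmul u u' a, hmul v v' b & hmul a b z].
Proof.
move=> uvw u'v'w' ww'z.
have : lift_hop hmul (hmul u v) [set w'] z by exists w => //; exists w'.
rewrite -hmulA => -[_ -> [c vw'c ucz]].
have : lift_hop hmul (hmul u' v') [set v] c.
  by exists w' => //; exists v => //; rewrite hmulC.
rewrite -hmulA => -[_ -> [b v'vb u'bc]].
have : lift_hop hmul [set u] (hmul u' b) z by exists u => //; exists c.
rewrite hmulA => -[a uu'a [_ -> abz]].
by exists a, b; split => //; rewrite hmulC.
Qed.

Lemma hyperideal0 I : hyperideal I -> I 0.
Proof. by move=> [[a Ia] IB _]; rewrite -(subrr a); exact: IB. Qed.

Lemma proper_hyperideal_hone I : proper_hyperideal I -> ~ I hone.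
Proof.
move=> [[_ _ IM] IT] I1; apply: IT; apply/seteqP; split => // r _.
exact: IM I1 _ (hmulr1 r).
Qed.

Lemma C_hyperideal_hmul I u v :
  C_hyperideal I -> hmul u v `&` I !=set0 -> hmul u v `<=` I.
Proof.
move=> [_ IC]; apply: IC; exists u, [:: v]; apply/seteqP; split => z.
  by move=> uvz; exists u => //; exists v.
by move=> [_ -> [_ ->]].
Qed.

Lemma hyperideal_bigcap (F : set (set R)) :
  (forall N, F N -> hyperideal N) -> hyperideal (\bigcap_(N in F) N).
Proof.
move=> FI; split.
- by exists 0 => N /FI/hyperideal0.
- by move=> a b Fa Fb N FN; have [_ NB _] := FI N FN; apply: NB; [exact: Fa|exact: Fb].
- by move=> r x Fx z rxz N FN; have [_ _ NM] := FI N FN; exact: NM (Fx N FN) _ rxz.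
Qed.

Lemma sub_hradical I : I `<=` hradical I.
Proof. by move=> x Ix P [_]; exact. Qed.

Lemma hyperideal_hradical I : hyperideal (hradical I).
Proof. by apply: hyperideal_bigcap => P [[[]]]. Qed.

Definition hcolon P x : set R := [set z | hmul z x `<=` P].

Lemma hyperideal_hcolon P x : hyperideal P -> hyperideal (hcolon P x).
Proof.
move=> PI; have [_ PB PM] := PI; split.
- by exists 0; rewrite /hcolon /= hmulC; apply: PM; exact: hyperideal0.
- move=> a b Pa Pb z /hmulDl[c acx [d]].
  rewrite hmulNr => -[e bxe <-] <-.
  by apply: PB; [exact: Pa|exact: Pb].
- move=> r z Pz w rzw t wxt.
  have : lift_hop hmul (hmul r z) [set x] t by exists w => //; exists x.
  by rewrite -hmulA => -[_ -> [c /Pz Pc]]; exact: PM.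
Qed.

Lemma sub_hcolon P x : hyperideal P -> P `<=` hcolon P x.
Proof. by move=> [_ _ PM] z Pz; rewrite /hcolon /= hmulC; exact: PM. Qed.

(** Asking only that products meet [T], rather than lie in it, makes [{1}] a
    system even when [1 o 1] has several elements. *)
Definition msystem T :=
  T !=set0 /\ forall u v, T u -> T v -> hmul u v `&` T !=set0.

Lemma msystem_hone : msystem [set (hone : R)].
Proof.
split; first by exists hone.
by move=> _ _ -> ->; exists hone; split => //; exact: hmulr1.
Qed.

(** If [x o y] lies in [P] and [y] does not, then the colon of [P] by [x] is
    larger than [P], hence contains some [u] in [T]; if [x] is not in [P]
    either, then the colon of [P] by [u] contains some [v] in [T], and [v o u]
    is a subset of [P] that meets [T]. *)
Lemma prime_of_maximal_disjoint T P :
  msystem T -> hyperideal P -> P `&` T = set0 ->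
  (forall N, hyperideal N -> P `<` N -> N `&` T !=set0) ->
  prime_hyperideal P.
Proof.
move=> [[t Tt] TM] PI PT0 Pmax.
have PT u : P u -> ~ T u by move=> Pu Tu; rewrite -[False]/(set0 u) -PT0.
have meet x y : hmul x y `<=` P -> ~ P y -> exists2 u, T u & hmul x u `<=` P.
  move=> xyP nPy; have [] := Pmax _ (hyperideal_hcolon x PI).
    split; first exact: sub_hcolon.
    by move=> /(_ y); rewrite /hcolon /= hmulC => /(_ xyP).
  by move=> u [xuP Tu]; exists u => //; rewrite hmulC.
split.
  by split=> // PTT; apply: (PT t) => //; rewrite PTT.
move=> x y xyP; apply: contrapT => /not_orP[nPx nPy].
have [u Tu xuP] := meet _ _ xyP nPy.
rewrite hmulC in xuP; have [v Tv uvP] := meet _ _ xuP nPx.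
have [w [uvw Tw]] := TM u v Tu Tv.
exact: PT (uvP _ uvw) Tw.
Qed.

Lemma maximal_prime M : maximal_hyperideal M -> prime_hyperideal M.
Proof.
move=> [Mp Mmax]; apply: (prime_of_maximal_disjoint msystem_hone).
- by case: Mp.
- apply/seteqP; split => // z [Mz z1].
  by apply: (proper_hyperideal_hone Mp); rewrite -z1.
- by move=> N NI /(Mmax _ NI) ->; exists hone.
Qed.

(** Krull's separation theorem, by Zorn's lemma. *)
Lemma prime_separation T I :
  msystem T -> hyperideal I -> I `&` T = set0 ->
  exists P, [/\ prime_hyperideal P, I `<=` P & P `&` T = set0].
Proof.
move=> Tm II IT0.
(* The empty chain has union [set0], so sets are joined with [I] before being
   required to be hyperideals. *)
pose G N := hyperideal (I `|` N) /\ (I `|` N) `&` T = set0.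
have [F FG Ftot|A [[AI AT0] Amax]] := @Zorn_bigcup _ G.
  have [_ IB IM] := II.
  have sup N : F N -> I `|` N `<=` I `|` \bigcup_(X in F) X.
    by move=> FN z [Iz|Nz]; [left|right; exists N].
  split; first split.
  - by exists 0; left; exact: hyperideal0.
  - move=> a b [Ia|[X FX Xa]] [Ib|[Y FY Yb]].
    + by left; exact: IB.
    + by have [[_ YB _] _] := FG Y FY; apply: (sup Y FY); apply: YB; [left|right].
    + by have [[_ XB _] _] := FG X FX; apply: (sup X FX); apply: XB; [right|left].
    + have [XY|YX] := Ftot X Y FX FY.
        have [[_ YB _] _] := FG Y FY; apply: (sup Y FY).
        by apply: YB; right => //; exact: XY.
      have [[_ XB _] _] := FG X FX; apply: (sup X FX).
      by apply: XB; right => //; exact: YX.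
  - move=> r x [Ix|[X FX Xx]] z rxz; first by left; exact: IM Ix _ rxz.
    have [[_ _ XM] _] := FG X FX; apply: (sup X FX).
    by apply: XM rxz; right.
  - apply/seteqP; split => // z [[Iz|[X FX Xz]] Tz]; first by rewrite -IT0.
    by have [_ <-] := FG X FX; split => //; right.
exists (I `|` A); split; [|exact: subsetUl|exact: AT0].
apply: (prime_of_maximal_disjoint Tm) => // N NI [AN nNA].
apply/set0P/negP => /eqP NT0.
have IN : I `|` N = N.
  by apply/seteqP; split => [z [Iz|//]|z]; [apply: AN; left|right].
apply: (Amax N); last by rewrite /G IN.
split; first by move=> z Az; apply: AN; right.
by move=> NA; apply: nNA => z /NA Az; right.
Qed.

(** A prime over [I] exists, as [I] can be separated from [{1}]; so the
    intersection defining [hradical I] is not over the empty family. *)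
Lemma proper_hradical I : proper_hyperideal I -> proper_hyperideal (hradical I).
Proof.
move=> Ip; split; first exact: hyperideal_hradical.
have [|P [Pprime IP P10]] := prime_separation msystem_hone (proj1 Ip).
  apply/seteqP; split => // z [Iz z1].
  by apply: (proper_hyperideal_hone Ip); rewrite -z1.
move=> radT; have : hradical I hone by rewrite radT.
by move=> /(_ P (conj Pprime IP)); exact: proper_hyperideal_hone (proj1 Pprime).
Qed.

(** Rearranging [(u o v) o (u' o v')] as [(u o u') o (v o v')] leaves the
    factors outside [M] and [P]: by the [C]-property, [u o u'] cannot even meet
    the prime [M] when [u] and [u'] are outside it, and similarly for [P]. *)
Lemma msystem_mul_setC M P :
  C_hyperideal M -> C_hyperideal P -> prime_hyperideal M -> prime_hyperideal P ->
  msystem (lift_hop hmul (~` M) (~` P)).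
Proof.
move=> MC PC Mprime Pprime.
have out N a b c : C_hyperideal N -> prime_hyperideal N ->
    ~ N a -> ~ N b -> hmul a b c -> ~ N c.
  move=> NC [_ Nmul] nNa nNb abc Nc.
  by have [||] := Nmul a b => //; apply: (C_hyperideal_hmul NC); exists c.
split.
  have [w w11] := hmul_nonempty (hone : R) hone.
  exists w, hone; first exact: proper_hyperideal_hone (proj1 Mprime).
  by exists hone => //; exact: proper_hyperideal_hone (proj1 Pprime).
move=> w w' [u nMu [v nPv uvw]] [u' nMu' [v' nPv' uvw']].
have [z ww'z] := hmul_nonempty w w'; exists z; split => //.
have [a [b [uu'a vv'b abz]]] := hmul_exchange uvw uvw' ww'z.
by exists a; [exact: out uu'a|exists b => //; exact: out vv'b].
Qed.

End HyperidealTheory.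

Theorem theorem4p5 (R : comMultHyperringType)
    (all_C : forall N : set R, hyperideal N -> C_hyperideal N)
    (I : set R) (I_proper : proper_hyperideal I) :
  quasi_J_prime I <->
  (I `<=` jacobson_radical R /\
   forall x y : R, hmul x y `<=` I -> jacobson I x \/ hradical I y).
Proof.
split.
  move=> [_ [radp radJ]]; split.
    move=> x Ix; have [||/(proper_hyperideal_hone radp)] := radJ x hone => //.
    rewrite hmulC; have [_ _ radM] := radp.1.
    by apply: radM; exact: sub_hradical.
  move=> x y xyI; have [|xJ|] := radJ x y; last by right.
    by move=> z /xyI; exact: sub_hradical.
  by left=> M [Mmax _]; exact: xJ.
move=> [IJ IM]; split=> //; split; first exact: proper_hradical.
move=> x y xyrad; apply: contrapT => /not_orP[].
move=> /existsNP[M /not_implyP[Mmax nMx]] /existsNP[P /not_implyP[[Pprime IP] nPy]].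
have Mprime := maximal_prime Mmax.
have [MI _] := Mprime.1; have [PI _] := Pprime.1.
pose T := lift_hop hmul (~` M) (~` P).
have IT0 : I `&` T = set0.
  apply/seteqP; split => // w [Iw [u nMu [v nPv uvw]]].
  have uvI : hmul u v `<=` I.
    by apply: C_hyperideal_hmul; [exact: all_C I_proper.1|exists w].
  have [uJ|vrad] := IM u v uvI.
    by apply: nMu; apply: uJ; split => // z /IJ; exact.
  by apply: nPv; exact: vrad.
have Tm : msystem T by apply: msystem_mul_setC => //; exact: all_C.
have [Q [Qprime IQ QT0]] := prime_separation Tm I_proper.1 IT0.
have [z xyz] := hmul_nonempty x y.
rewrite -[False]/(set0 z) -QT0; split; first exact: xyrad xyz Q (conj Qprime IQ).
by exists x => //; exists y.
Qed.
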